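(* Let $p$ be a prime number and let $(R,\mathcal{I})$ be a prism. Suppose that $R/\mathcal{I}$ is of bounded $p$-torsion. Then the following hold. (a) $(\mathcal{I},p)$ is proregular, i.e. for each positive integer $n$ there is an integer $m\ge n$ such that the multiplication map $\mathcal{I}^m :_R p^m/\mathcal{I}^m \xrightarrow{\ p^{m-n}\ } \mathcal{I}^n :_R p^n/\mathcal{I}^n$ is the zero map. (b) $\Gamma_{\mathcal{I}}(I)/\Gamma_{(\mathcal{I},p)}(I)$ is $p$-divisible for any injective $R$-module $I$, i.e. $\Gamma_{\mathcal{I}}(I) = p\,\Gamma_{\mathcal{I}}(I)+\Gamma_{(\mathcal{I},p)}(I)$. Moreover, the conditions (a) and (b) are equivalent.
   Context: All rings are commutative. $R$ is an algebra over the localization $\mathbb{Z}_{(p)}$ of $\mathbb{Z}$ at the prime ideal $(p)$. Covering sequence: a sequence $f_1,\ldots,f_r$ of elements of $R$ with $\operatorname{Spec}R=\bigcup_{i=1}^r D(f_i)$, equivalently $(f_1,\ldots,f_r)R=R$. Effective Cartier divisor: an ideal $\mathcal{I}\subset R$ for which there is a covering sequence $f_1,\ldots,f_r$ such that $\mathcal{I}R_{f_i}=x_iR_{f_i}$, $i=1,\ldots,r$, for non-zerodivisors $x_i$ of $R$. $\delta$-ring: a ring $R$ with a map $\delta:R\to R$ such that $\delta(0)=\delta(1)=0$, $\delta(ab)=a^p\delta(b)+b^p\delta(a)+p\,\delta(a)\delta(b)$ and $\delta(a+b)=\delta(a)+\delta(b)+\frac{a^p+b^p-(a+b)^p}{p}$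 (the last term being the evident integer polynomial in $a,b$). The associated lift of Frobenius is the ring homomorphism $\phi_R(a)=a^p+p\,\delta(a)$. Prism: a pair $(R,\mathcal{I})$ consisting of a $\delta$-ring $R$ and an (effective) Cartier divisor $\mathcal{I}$ on $R$ such that $R$ is $(p,\mathcal{I})$-adically complete and $p\in\mathcal{I}+\phi_R(\mathcal{I})R$. Bounded torsion: an $R$-module $M$ is of bounded $x$-torsion ($x\in R$) if there is an integer $c$ with $0:_M x^n=0:_M x^c$ for all $n\ge c$. For an ideal $\mathfrak{a}$ and an $R$-module $X$, $\Gamma_{\mathfrak{a}}(X)=\{u\in X:\mathfrak{a}^nu=0\text{ for some }n\ge1\}$. Also $\mathfrak{a}:_R y=\{a\in R: ya\in\mathfrak{a}\}$. A module $X$ is $p$-divisible if $X=pX$. *)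

(* Defs.v *)
From HB Require Import structures.
From mathcomp Require Import all_boot all_algebra ring.
From mathcomp Require Import boolp classical_sets.

Set Implicit Arguments.
Unset Strict Implicit.
Unset Printing Implicit Defensive.

Import GRing.Theory.

Local Open Scope ring_scope.
Local Open Scope classical_set_scope.
Local Open Scope quotient_scope.

Definition is_submodule (R : pzRingType) (M : lmodType R) (N : set M) : Prop :=
  N 0 /\ forall (a : R) (u v : M), N u -> N v -> N (a *: u + v).

Definition submodule_gen (R : pzRingType) (M : lmodType R) (S : set M) : set M :=
  smallest (@is_submodule R M) S.

(* Ideals are the submodules of the regular module. *)
Definition is_ideal (R : comPzRingType) (I : set R) : Prop :=
  @is_submodule R R^o I.

Definition ideal_gen (R : comPzRingType) (S : set R) : set R :=
  @submodule_gen R R^o S.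

Definition ideal_add (R : comPzRingType) (I J : set R) : set R :=
  [set a + b | a in I & b in J].

Definition ideal_mul (R : comPzRingType) (I J : set R) : set R :=
  ideal_gen [set a * b | a in I & b in J].

Definition ideal_pow (R : comPzRingType) (I : set R) (n : nat) : set R :=
  iter n (ideal_mul I) setT.

Definition colon (R : comPzRingType) (I : set R) (y : R) : set R :=
  [set a | I (y * a)].

Lemma submodule_gen_is_submodule (R : pzRingType) (M : lmodType R) (S : set M) :
  is_submodule (submodule_gen S).
Proof.
split=> [N [[N0 _] _] //|a u v Su Sv N HN]; have [[_ NP] _] := HN.
by apply: NP; [exact: Su|exact: Sv].
Qed.

(* The quotient of M by the submodule generated by N; in particular M / N when
   N is a submodule. *)
Section QuotientModule.
Variables (R : pzRingType) (M : lmodType R) (N : set M).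

Definition quotmod_rel (u v : M) : bool := `[< submodule_gen N (u - v) >].

Lemma quotmod_rel_equiv : equiv_class_of quotmod_rel.
Proof.
have [G0 GP] := submodule_gen_is_submodule N.
split=> [u|u v|v u w].
- by apply/asboolP; rewrite subrr.
- by apply/asbool_equiv_eq; split=> h; rewrite -opprB -[X in _ X]addr0 -scaleN1r;
    exact: GP.
- move=> /asboolP uv /asboolP vw; apply/asboolP.
  by have := GP 1 _ _ uv vw; rewrite scale1r addrA subrK.
Qed.

Canonical quotmod_equiv := EquivRelPack quotmod_rel_equiv.

Definition quotmod : Type := {eq_quot quotmod_equiv}.

HB.instance Definition _ := Choice.on quotmod.
HB.instance Definition _ := EqQuotient.on quotmod.

Definition quotmod_pi (u : M) : quotmod := \pi_quotmod u.

Lemma quotmod_piP (u v : M) :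
  quotmod_pi u = quotmod_pi v <-> submodule_gen N (u - v).
Proof.
by split=> [/eqquotP/asboolP //|h]; apply/eqquotP/asboolP.
Qed.

Let rep (x : quotmod) : M := repr x.

Let piK (x : quotmod) : quotmod_pi (rep x) = x.
Proof. exact: reprK. Qed.

Let repP (u : M) : submodule_gen N (rep (quotmod_pi u) - u).
Proof. by apply/quotmod_piP; rewrite piK. Qed.

Definition quotmod_add (x y : quotmod) := quotmod_pi (rep x + rep y).
Definition quotmod_opp (x : quotmod) := quotmod_pi (- rep x).
Definition quotmod_scale (a : R) (x : quotmod) := quotmod_pi (a *: rep x).

Lemma quotmod_piD u v :
  quotmod_pi (u + v) = quotmod_add (quotmod_pi u) (quotmod_pi v).
Proof.
symmetry; apply/quotmod_piP; have [_ GP] := submodule_gen_is_submodule N.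
by have := GP 1 _ _ (repP u) (repP v); rewrite scale1r addrACA -opprD.
Qed.

Lemma quotmod_piZ a u : quotmod_pi (a *: u) = quotmod_scale a (quotmod_pi u).
Proof.
symmetry; apply/quotmod_piP; have [G0 GP] := submodule_gen_is_submodule N.
by have := GP a _ _ (repP u) G0; rewrite addr0 scalerBr.
Qed.

Lemma quotmod_piN u : quotmod_pi (- u) = quotmod_opp (quotmod_pi u).
Proof. by rewrite -scaleN1r quotmod_piZ /quotmod_scale scaleN1r. Qed.

Lemma quotmod_addA : associative quotmod_add.
Proof.
by move=> x y z; rewrite -(piK x) -(piK y) -(piK z) -!quotmod_piD addrA.
Qed.

Lemma quotmod_addC : commutative quotmod_add.
Proof. by move=> x y; rewrite -(piK x) -(piK y) -!quotmod_piD addrC. Qed.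

Lemma quotmod_add0 : left_id (quotmod_pi 0) quotmod_add.
Proof. by move=> x; rewrite -(piK x) -!quotmod_piD add0r. Qed.

Lemma quotmod_addN : left_inverse (quotmod_pi 0) quotmod_opp quotmod_add.
Proof. by move=> x; rewrite -(piK x) -quotmod_piN -!quotmod_piD addNr. Qed.

HB.instance Definition _ := GRing.isZmodule.Build quotmod
  quotmod_addA quotmod_addC quotmod_add0 quotmod_addN.

Lemma quotmod_scaleA a b x :
  quotmod_scale a (quotmod_scale b x) = quotmod_scale (a * b) x.
Proof. by rewrite -(piK x) -!quotmod_piZ scalerA. Qed.

Lemma quotmod_scale1 : left_id 1 quotmod_scale.
Proof. by move=> x; rewrite -(piK x) -!quotmod_piZ scale1r. Qed.

Lemma quotmod_scaleDr : right_distributive quotmod_scale +%R.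
Proof.
move=> a x y; rewrite -(piK x) -(piK y).
by rewrite -[X in quotmod_scale a X]quotmod_piD -!quotmod_piZ scalerDr quotmod_piD.
Qed.

Lemma quotmod_scaleDl x : {morph quotmod_scale^~ x : a b / a + b}.
Proof.
by move=> a b; rewrite -(piK x) -!quotmod_piZ scalerDl quotmod_piD.
Qed.

HB.instance Definition _ := GRing.Zmodule_isLmodule.Build R quotmod
  quotmod_scaleA quotmod_scale1 quotmod_scaleDr quotmod_scaleDl.

Lemma quotmod_pi_is_linear : linear quotmod_pi.
Proof. by move=> a u v; rewrite quotmod_piD quotmod_piZ. Qed.

HB.instance Definition _ :=
  GRing.isLinear.Build R M quotmod *:%R quotmod_pi quotmod_pi_is_linear.

End QuotientModule.

Definition quot_ideal (R : comPzRingType) (J : set R) : lmodType R :=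
  @quotmod R R^o J.

Definition quot_class (R : comPzRingType) (J : set R) (a : R) : quot_ideal J :=
  @quotmod_pi R R^o J a.

(* The localization of R at the multiplicative monoid generated by S; in
   particular S^-1 R when S is multiplicatively closed, and R_f when
   S = [set f]. *)
Section Localization.
Variables (R : comPzRingType) (S : set R).

Definition is_mulset (D : set R) : Prop :=
  D 1 /\ forall x y, D x -> D y -> D (x * y).

Definition denom : set R := smallest is_mulset S.

Lemma denom_is_mulset : is_mulset denom.
Proof.
split=> [D [[D1 _] _] //|x y Sx Sy D HD]; have [[_ DM] _] := HD.
by apply: DM; [exact: Sx|exact: Sy].
Qed.

Definition frac : Type := (R * {s : R | `[< denom s >]})%type.

HB.instance Definition _ := Choice.on frac.

Definition num (x : frac) : R := x.1.
Definition den (x : frac) : R := val x.2.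

Lemma denP x : denom (den x). Proof. exact/asboolP/(valP x.2). Qed.

Definition mkfrac (a s : R) (hs : denom s) : frac := (a, exist _ s (asboolT hs)).

Definition loc_rel (x y : frac) : bool :=
  `[< exists2 u, denom u & u * (num x * den y) = u * (num y * den x) >].

Lemma loc_rel_equiv : equiv_class_of loc_rel.
Proof.
have [D1 DM] := denom_is_mulset; split=> [x|x y|y x z].
- by apply/asboolP; exists 1.
- by apply/asbool_equiv_eq; split=> -[u Du e]; exists u.
- move=> /asboolP[u Du e] /asboolP[v Dv e']; apply/asboolP.
  exists (u * v * den y); first by apply: (DM _ _ (DM _ _ Du Dv)); exact: denP.
  have -> : u * v * den y * (num x * den z) = v * den z * (u * (num x * den y)).
    by ring.
  rewrite e.
  have -> : v * den z * (u * (num y * den x)) = u * den x * (v * (num y * den z)).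
    by ring.
  by rewrite e'; ring.
Qed.

Canonical loc_equiv := EquivRelPack loc_rel_equiv.

Definition loc : Type := {eq_quot loc_equiv}.

HB.instance Definition _ := Choice.on loc.
HB.instance Definition _ := EqQuotient.on loc.

Definition loc_pi (x : frac) : loc := \pi_loc x.

Lemma loc_piP (x y : frac) : loc_pi x = loc_pi y <->
  exists2 u, denom u & u * (num x * den y) = u * (num y * den x).
Proof.
by split=> [/eqquotP/asboolP //|h]; apply/eqquotP/asboolP.
Qed.

Let rep (x : loc) : frac := repr x.

Let piK (x : loc) : loc_pi (rep x) = x.
Proof. exact: reprK. Qed.

Let repP (x : frac) :
  exists2 u, denom u & u * (num (rep (loc_pi x)) * den x) =
                       u * (num x * den (rep (loc_pi x))).
Proof. by apply/loc_piP; rewrite piK. Qed.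

Lemma denomM x y : denom (den x * den y).
Proof. by apply: (denom_is_mulset.2); exact: denP. Qed.

Definition frac_add (x y : frac) : frac :=
  mkfrac (num x * den y + num y * den x) (denomM x y).
Definition frac_mul (x y : frac) : frac :=
  mkfrac (num x * num y) (denomM x y).
Definition frac_opp (x : frac) : frac := mkfrac (- num x) (denP x).
Definition frac_of (a : R) : frac := mkfrac a (denom_is_mulset.1).

Let fracE := (
  (fun x y : frac => erefl : num (frac_add x y) = num x * den y + num y * den x),
  (fun x y : frac => erefl : den (frac_add x y) = den x * den y),
  (fun x y : frac => erefl : num (frac_mul x y) = num x * num y),
  (fun x y : frac => erefl : den (frac_mul x y) = den x * den y),
  (fun x : frac => erefl : num (frac_opp x) = - num x),
  (fun x : frac => erefl : den (frac_opp x) = den x),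
  (fun a : R => erefl : num (frac_of a) = a),
  (fun a : R => erefl : den (frac_of a) = 1),
  (fun (a s : R) (hs : denom s) => erefl : num (mkfrac a hs) = a),
  (fun (a s : R) (hs : denom s) => erefl : den (mkfrac a hs) = s)).

Definition loc_add (x y : loc) := loc_pi (frac_add (rep x) (rep y)).
Definition loc_mul (x y : loc) := loc_pi (frac_mul (rep x) (rep y)).
Definition loc_opp (x : loc) := loc_pi (frac_opp (rep x)).
Definition loc_inj (a : R) : loc := loc_pi (frac_of a).

Lemma loc_piD x y : loc_pi (frac_add x y) = loc_add (loc_pi x) (loc_pi y).
Proof.
symmetry; apply/loc_piP.
have [u Du e] := repP x; have [v Dv f] := repP y.
exists (u * v); first exact: denom_is_mulset.2.
move: (rep _) (rep _) e f => y' x'; rewrite !fracE => e f.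
transitivity (v * den y * den y' * (u * (num x' * den x)) +
              u * den x * den x' * (v * (num y' * den y))); first by ring.
by rewrite e f; ring.
Qed.

Lemma loc_piM x y : loc_pi (frac_mul x y) = loc_mul (loc_pi x) (loc_pi y).
Proof.
symmetry; apply/loc_piP.
have [u Du e] := repP x; have [v Dv f] := repP y.
exists (u * v); first exact: denom_is_mulset.2.
move: (rep _) (rep _) e f => y' x'; rewrite !fracE => e f.
transitivity ((u * (num x' * den x)) * (v * (num y' * den y))); first by ring.
by rewrite e f; ring.
Qed.

Lemma loc_piN x : loc_pi (frac_opp x) = loc_opp (loc_pi x).
Proof.
symmetry; apply/loc_piP; have [u Du e] := repP x; exists u => //.
by move: (rep _) e => x'; rewrite !fracE => e; rewrite !mulNr !mulrN e.
Qed.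

Let loc_pi_eq x y : num x * den y = num y * den x -> loc_pi x = loc_pi y.
Proof.
by move=> e; apply/loc_piP; exists 1; [exact: denom_is_mulset.1|rewrite e].
Qed.

Lemma loc_addA : associative loc_add.
Proof.
move=> x y z; rewrite -(piK x) -(piK y) -(piK z) -!loc_piD.
by apply: loc_pi_eq; rewrite !fracE; ring.
Qed.

Lemma loc_addC : commutative loc_add.
Proof.
move=> x y; rewrite -(piK x) -(piK y) -!loc_piD.
by apply: loc_pi_eq; rewrite !fracE; ring.
Qed.

Lemma loc_add0 : left_id (loc_inj 0) loc_add.
Proof.
move=> x; rewrite -(piK x) -!loc_piD.
by apply: loc_pi_eq; rewrite !fracE; ring.
Qed.

Lemma loc_addN : left_inverse (loc_inj 0) loc_opp loc_add.
Proof.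
move=> x; rewrite -(piK x) -loc_piN -!loc_piD.
by apply: loc_pi_eq; rewrite !fracE; ring.
Qed.

HB.instance Definition _ := GRing.isZmodule.Build loc
  loc_addA loc_addC loc_add0 loc_addN.

Lemma loc_mulA : associative loc_mul.
Proof.
move=> x y z; rewrite -(piK x) -(piK y) -(piK z) -!loc_piM.
by apply: loc_pi_eq; rewrite !fracE; ring.
Qed.

Lemma loc_mulC : commutative loc_mul.
Proof.
move=> x y; rewrite -(piK x) -(piK y) -!loc_piM.
by apply: loc_pi_eq; rewrite !fracE; ring.
Qed.

Lemma loc_mul1 : left_id (loc_inj 1) loc_mul.
Proof.
move=> x; rewrite -(piK x) -!loc_piM.
by apply: loc_pi_eq; rewrite !fracE; ring.
Qed.

Lemma loc_mulDl : left_distributive loc_mul +%R.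
Proof.
move=> x y z; rewrite -(piK x) -(piK y) -(piK z).
rewrite -[X in loc_mul X _]loc_piD -!loc_piM.
rewrite -[RHS]loc_piD.
by apply: loc_pi_eq; rewrite !fracE; ring.
Qed.

HB.instance Definition _ := GRing.Zmodule_isComPzRing.Build loc
  loc_mulA loc_mulC loc_mul1 loc_mulDl.

Lemma loc_inj_is_additive : zmod_morphism loc_inj.
Proof.
move=> a b; transitivity (loc_add (loc_inj a) (loc_opp (loc_inj b))) => //.
rewrite -loc_piN -loc_piD.
by apply: loc_pi_eq; rewrite !fracE; ring.
Qed.

Lemma loc_inj_is_monoid_morphism : monoid_morphism loc_inj.
Proof.
split=> // a b; transitivity (loc_mul (loc_inj a) (loc_inj b)) => //.
rewrite -loc_piM.
by apply: loc_pi_eq; rewrite !fracE; ring.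
Qed.

HB.instance Definition _ :=
  GRing.isZmodMorphism.Build R loc loc_inj loc_inj_is_additive.
HB.instance Definition _ :=
  GRing.isMonoidMorphism.Build R loc loc_inj loc_inj_is_monoid_morphism.

Lemma loc_inj_inv s : denom s -> exists t : loc, loc_inj s * t = 1.
Proof.
move=> Ds; exists (loc_pi (mkfrac 1 Ds)).
transitivity (loc_mul (loc_inj s) (loc_pi (mkfrac 1 Ds))) => //.
rewrite -loc_piM.
by apply: loc_pi_eq; rewrite !fracE; ring.
Qed.

End Localization.

(* For p prime, the integers outside (p) already form a monoid, so this is
   Z_(p). *)
Definition Zlocal (p : nat) : comPzRingType :=
  loc [set n : int | ~ (p%:Z %| n)%Z].

Definition covering (R : comPzRingType) (r : nat) (f : 'I_r -> R) : Prop :=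
  ideal_gen (range f) = setT.

Definition effective_cartier_divisor (R : comPzRingType) (I : set R) : Prop :=
  is_ideal I /\
  exists (r : nat) (f x : 'I_r -> R),
    covering f /\
    forall i : 'I_r, GRing.lreg (x i) /\
      ideal_gen (@loc_inj R [set f i] @` I) =
      ideal_gen [set @loc_inj R [set f i] (x i)].

(* For p prime and 0 < i < p, p divides 'C(p, i), so the sum below is
   (a^p + b^p - (a + b)^p) / p with a sign. *)
Record is_delta (p : nat) (R : comPzRingType) (delta : R -> R) : Prop := {
  delta0 : delta 0 = 0;
  delta1 : delta 1 = 0;
  deltaM : forall a b, delta (a * b) =
    a ^+ p * delta b + b ^+ p * delta a + p%:R * delta a * delta b;
  deltaD : forall a b, delta (a + b) = delta a + delta b -
    \sum_(1 <= i < p) (a ^+ i * b ^+ (p - i)) *+ ('C(p, i) %/ p) }.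

Definition frob_lift (p : nat) (R : comPzRingType) (delta : R -> R) (a : R) : R :=
  a ^+ p + p%:R * delta a.

(* The canonical map from R to the limit of the R / J^n is bijective: the first
   clause is its injectivity, and the second its surjectivity, a compatible
   family of classes being given by representatives u n. *)
Definition adically_complete (R : comPzRingType) (J : set R) : Prop :=
  (forall x : R, (forall n, ideal_pow J n x) -> x = 0) /\
  (forall u : nat -> R, (forall n, ideal_pow J n (u n.+1 - u n)) ->
     exists x : R, forall n, ideal_pow J n (x - u n)).

Record is_prism (p : nat) (R : comPzRingType) (delta : R -> R) (I : set R)
    : Prop := {
  prism_delta : is_delta p delta;
  prism_cartier : effective_cartier_divisor I;
  prism_complete :
    adically_complete (ideal_add (ideal_gen [set p%:R]) I);
  prism_p : ideal_add I (ideal_gen (frob_lift p delta @` I)) p%:R }.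

Definition bounded_torsion (R : comPzRingType) (M : lmodType R) (x : R) : Prop :=
  exists c : nat, forall n : nat, (c <= n)%N ->
    [set u : M | x ^+ n *: u = 0] = [set u : M | x ^+ c *: u = 0].

(* The pair (I, x) is proregular: the map induced by multiplication by
   x ^ (m - n) from (I^m : x^m) / I^m to (I^n : x^n) / I^n sends the class of a
   to the class of x ^ (m - n) * a, here taken in R / I^n. *)
Definition proregular (R : comPzRingType) (I : set R) (x : R) : Prop :=
  forall n : nat, (0 < n)%N -> exists2 m : nat, (n <= m)%N &
    forall a : R, colon (ideal_pow I m) (x ^+ m) a ->
      quot_class (ideal_pow I n) (x ^+ (m - n) * a) = 0.

Definition injective_module (R : pzRingType) (E : lmodType R) : Prop :=
  forall (M N : lmodType R) (i : {linear M -> N}) (g : {linear M -> E}),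
    injective i -> exists h : {linear N -> E}, forall u : M, h (i u) = g u.

Definition Gamma (R : comPzRingType) (J : set R) (X : lmodType R) : set X :=
  [set u | exists2 n : nat, (1 <= n)%N & forall a, ideal_pow J n a -> a *: u = 0].
Arguments Gamma {R} J X.

(* X / Y is x-divisible, i.e. X = x X + Y, for X = Gamma_I(E) and its submodule
   Y = Gamma_(I,x)(E), E ranging over the injective R-modules. *)
Definition Gamma_quot_divisible (R : comPzRingType) (I : set R) (x : R) : Prop :=
  forall E : lmodType R, injective_module E ->
    Gamma I E =
    [set x *: u + v | u in Gamma I E &
                      v in Gamma (ideal_add I (ideal_gen [set x])) E].

(* Main.v *)
(* Locally I = (x) with x a non-zerodivisor, so each I^n/I^(n+1) is locally R/I
   and bounded p-torsion passes from R/I to R/I^n, with the exponent multiplied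
   by n; this gives (a).
   If (a) holds and I^n u = 0 in an injective E, then p^m r |-> p^(m-n) r u is
   well defined on the submodule p^m (R/I^m) of R/I^m and extends to R/I^m,
   which yields v in Gamma_I(E) with p^(m-n) (u - p^n v) = 0; this gives (b).
   Conversely, embed R/I^n in an injective E and iterate (b) from the class u
   of 1: p^k u = p^(k+n) v with I^l v = 0, so m = k + n + l works. *)
From HB Require Import structures.
Require Import Defs.
From mathcomp Require Import all_boot all_order all_algebra.
From mathcomp Require Import boolp classical_sets functions.
From mathcomp Require Import ring zify.

Set Implicit Arguments.
Unset Strict Implicit.
Unset Printing Implicit Defensive.

Import Order.TTheory GRing.Theory Num.Theory.

Local Open Scope ring_scope.

(** * Submodules and ideals generated by a set *)

Section Submodules.
Variables (R : pzRingType) (M : lmodType R).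
Implicit Types (N S : set M) (u v : M).

Lemma submodule0 N : is_submodule N -> N 0.
Proof. by case. Qed.

Lemma submoduleD N u v : is_submodule N -> N u -> N v -> N (u + v).
Proof. by move=> [_ NP] Nu Nv; rewrite -[u]scale1r; exact: NP. Qed.

Lemma submoduleZ N a u : is_submodule N -> N u -> N (a *: u).
Proof. by move=> [N0 NP] Nu; rewrite -[a *: u]addr0; exact: NP. Qed.

Lemma sub_submodule_gen S : (S `<=` submodule_gen S)%classic.
Proof. by move=> u Su N [_ SN]; exact: SN. Qed.

Lemma submodule_gen_sub S N :
  is_submodule N -> (S `<=` N)%classic -> (submodule_gen S `<=` N)%classic.
Proof. by move=> HN SN u; apply. Qed.

Lemma submodule_gen_id N u : is_submodule N -> submodule_gen N u <-> N u.
Proof.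
by move=> HN; split; [exact: submodule_gen_sub|exact: sub_submodule_gen].
Qed.

End Submodules.

Section Ideals.
Variable R : comPzRingType.
Implicit Types (I J : set R) (a b x y : R) (n m : nat).

Lemma ideal_gen_is_ideal (S : set R) : is_ideal (ideal_gen S).
Proof. exact: submodule_gen_is_submodule. Qed.

Lemma ideal0 I : is_ideal I -> I 0.
Proof. exact: submodule0. Qed.

Lemma idealD I a b : is_ideal I -> I a -> I b -> I (a + b).
Proof. exact: submoduleD. Qed.

Lemma idealMl I a b : is_ideal I -> I b -> I (a * b).
Proof. exact: (@submoduleZ R R^o). Qed.

Lemma ideal_gen1P x y : ideal_gen [set x]%classic y <-> exists r, y = r * x.
Proof.
split=> [|[r ->]]; last first.
  apply: (idealMl _ (ideal_gen_is_ideal _)).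
  exact: (@sub_submodule_gen R R^o).
apply: (@submodule_gen_sub R R^o _ [set y | exists r, y = r * x]%classic).
  split=> [|a _ _ [r ->] [s ->]]; first by exists 0; rewrite mul0r.
  by exists (a * r + s); rewrite mulrDl -mulrA.
by move=> _ ->; exists 1; rewrite mul1r.
Qed.

End Ideals.

(** * Powers of ideals, covering sequences and passage to [R_f] *)

Section IdealPowers.
Variable R : comPzRingType.
Implicit Types (I J : set R) (a b x y : R) (n m : nat).

Lemma ideal_pow_is_ideal I n : is_ideal (ideal_pow I n).
Proof. by case: n => [|n]; [split|exact: ideal_gen_is_ideal]. Qed.

#[local] Hint Resolve ideal_pow_is_ideal : core.

Lemma ideal_powSM I n a b : I a -> ideal_pow I n b -> ideal_pow I n.+1 (a * b).
Proof.
by move=> Ia Ib; apply: (@sub_submodule_gen R R^o); exists a => //; exists b.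
Qed.

Lemma ideal_powS_ind I n (K : set R) : is_ideal K ->
  (forall a b, I a -> ideal_pow I n b -> K (a * b)) ->
  (ideal_pow I n.+1 `<=` K)%classic.
Proof.
move=> HK IK; apply: (@submodule_gen_sub R R^o) => // _ [a Ia [b Ib <-]].
exact: IK.
Qed.

Lemma ideal_powX I n a : I a -> ideal_pow I n (a ^+ n).
Proof.
by move=> Ia; elim: n => // n IHn; rewrite exprS; exact: ideal_powSM.
Qed.

Lemma ideal_powXM I n m a b :
  I a -> ideal_pow I m b -> ideal_pow I (n + m) (a ^+ n * b).
Proof.
move=> Ia Ib; elim: n => [|n IHn]; first by rewrite mul1r.
by rewrite exprS -mulrA addSn; exact: ideal_powSM.
Qed.

Lemma ideal_pow_le I n m :
  (n <= m)%N -> (ideal_pow I m `<=` ideal_pow I n)%classic.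
Proof.
move=> /subnK <-; elim: (m - n)%N => // k IHk; apply: subset_trans IHk.
by rewrite addSn; apply: ideal_powS_ind => // a b _; exact: idealMl.
Qed.

Lemma ideal_pow_sub I J n :
  (I `<=` J)%classic -> (ideal_pow I n `<=` ideal_pow J n)%classic.
Proof.
move=> IJ; elim: n => // n IHn; apply: ideal_powS_ind => // a b Ia Ib.
by apply: ideal_powSM; [exact: IJ|exact: IHn].
Qed.

Lemma radical_is_ideal I :
  is_ideal I -> is_ideal [set a | exists n, I (a ^+ n)]%classic.
Proof.
move=> HI; split=> [|c a b [n Ia] [m Ib]].
  by exists 1%N; rewrite expr1; exact: ideal0 HI.
exists (n + m)%N; rewrite exprDn.
apply: (big_ind I) => [|x y|k _]; first exact: ideal0 HI.
  exact: idealD.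
rewrite -mulr_natl; apply: idealMl => //.
have [le_mk|/ltnW le_km] := leqP m k.
  by rewrite -(subnK le_mk) exprD mulrA; exact: idealMl.
rewrite -addnBA // exprD -mulrA mulrC; apply: idealMl => //.
by rewrite [_ ^+ n]exprMn; exact: idealMl.
Qed.

(** Membership is local: the radical of [I : y] is an ideal containing every [f i], hence contains
    1. *)
Lemma covering_ideal (r : nat) (f : 'I_r -> R) I y : covering f ->
  is_ideal I -> (forall i, exists n, I (f i ^+ n * y)) -> I y.
Proof.
move=> covf HI fI.
have HIy : is_ideal (colon I y).
  split=> [|a b c]; rewrite /colon /= ?mulr0; first exact: ideal0 HI.
  move=> Ib Ic; rewrite mulrDr; apply: idealD => //.
  by rewrite /GRing.scale /= mulrCA; exact: idealMl.
suff [n] : [set a | exists n, colon I y (a ^+ n)]%classic 1.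
  by rewrite expr1n /colon /= mulr1.
have : ideal_gen (range f) 1 by rewrite covf.
apply: (@submodule_gen_sub R R^o); first exact: radical_is_ideal.
by move=> _ [i _ <-]; have [n fn] := fI i; exists n; rewrite /colon /= mulrC.
Qed.

Lemma denom1P (f : R) s : denom [set f]%classic s -> exists n, s = f ^+ n.
Proof.
move=> /(_ [set t | exists n, t = f ^+ n]%classic); apply.
split=> [|_ ->]; last by exists 1%N.
split; first by exists 0%N.
by move=> _ _ [n ->] [m ->]; exists (n + m)%N; rewrite exprD.
Qed.

Lemma loc_inj_eqP (f : R) a b :
  loc_inj [set f]%classic a = loc_inj [set f]%classic b ->
  exists n, f ^+ n * a = f ^+ n * b.
Proof.
move=> /loc_piP[u /denom1P[n ->]]; rewrite /num /den /= !mulr1.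
by exists n.
Qed.

Lemma loc_inj_den (f : R) (t : loc [set f]%classic) :
  exists n a, loc_inj _ (f ^+ n) * t = loc_inj _ a.
Proof.
rewrite -[t]reprK; move: (repr t) => x.
have [n def_n] := denom1P (denP x); exists n, (num x); rewrite -def_n.
transitivity (loc_mul (loc_inj [set f]%classic (den x)) (loc_pi x)) => //.
rewrite -loc_piM; apply/loc_piP; exists 1; first exact: (denom_is_mulset _).1.
by change (1 * (den x * num x * 1) = 1 * (num x * (1 * den x))); ring.
Qed.

(** * Ideals that become principal in [R_f] *)

Section LocallyPrincipal.
Variables (I : set R) (f x : R).
Local Notation inj_f := (loc_inj [set f]%classic).
Hypothesis HI : is_ideal I.
Hypothesis Ix : ideal_gen (inj_f @` I)%classic = ideal_gen [set inj_f x]%classic.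

(** One power of [f] clears the denominator of the cofactor in [R_f]; a second turns the resulting
    equality of images into one in [R]. *)
Lemma locally_principal_dvd y : I y -> exists n r, f ^+ n * y = r * x.
Proof.
move=> Iy.
have /ideal_gen1P[t def_y] : ideal_gen [set inj_f x]%classic (inj_f y).
  by rewrite -Ix; apply: (@sub_submodule_gen _ (loc [set f]%classic)^o);
    exists y.
have [n [a def_a]] := loc_inj_den t.
have [m] : exists m, f ^+ m * (f ^+ n * y) = f ^+ m * (a * x).
  by apply: loc_inj_eqP; rewrite !rmorphM /= def_y mulrA def_a.
by move=> e; exists (m + n)%N, (f ^+ m * a); rewrite exprD -!mulrA.
Qed.

Lemma locally_principal_mem : exists n, I (f ^+ n * x).
Proof.
(* [x] itself need not lie in [I]. The fractions that some power of [f] carries into the image of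
   [I] form an ideal of [R_f] containing that image, hence containing the generator [x]. *)
pose K : set (loc [set f]%classic) :=
  [set z | exists n, exists2 y, I y & inj_f (f ^+ n) * z = inj_f y]%classic.
suff [n [y Iy]] : K (inj_f x).
  rewrite -rmorphM => /loc_inj_eqP[m e]; exists (m + n)%N.
  by rewrite exprD -mulrA e; exact: idealMl.
have : ideal_gen (inj_f @` I)%classic (inj_f x).
  by rewrite Ix; apply: (@sub_submodule_gen _ (loc [set f]%classic)^o).
apply: (@submodule_gen_sub _ (loc [set f]%classic)^o) => [|_ [y Iy <-]];
  last first.
  by exists 0%N, y; rewrite // expr0 rmorph1 mul1r.
split=> [|c z w [n [y Iy ny]] [m [y' Iy' my']]].
  by exists 0%N, 0; rewrite ?rmorph0 ?mulr0 //; exact: ideal0 HI.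
have [k [a def_a]] := loc_inj_den c.
exists (n + m + k)%N, (f ^+ m * a * y + f ^+ (n + k) * y').
  by apply: idealD => //; exact: idealMl.
rewrite rmorphD !rmorphM /= -def_a -ny -my' !exprD !rmorphM /GRing.scale /=.
ring.
Qed.

Lemma locally_principal_powdvd n b :
  ideal_pow I n b -> exists k r, f ^+ k * b = r * x ^+ n.
Proof.
move: b; elim: n => [|n IHn] b.
  by exists 0%N, b; rewrite mul1r mulr1.
move: b; apply: (@ideal_powS_ind I n
  [set b | exists k r, f ^+ k * b = r * x ^+ n.+1]%classic) => [|a b Ia Ib].
  split=> [|c a b [k [r kr]] [l [s ls]]].
    by exists 0%N, 0; rewrite mulr0 mul0r.
  exists (k + l)%N, (f ^+ l * c * r + f ^+ k * s).
  rewrite [RHS]mulrDl -!mulrA -kr -ls exprD /GRing.scale /=; ring.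
have [k [r kr]] := locally_principal_dvd Ia.
have [l [s ls]] := IHn b Ib.
exists (k + l)%N, (r * s).
transitivity ((f ^+ k * a) * (f ^+ l * b)); first by rewrite exprD; ring.
by rewrite kr ls exprS; ring.
Qed.

(* Dividing by x ^ n turns torsion modulo I ^ (n + 1) of an element of I ^ n
   into torsion modulo I. *)
Lemma locally_principal_torsion (q : R) (c k n : nat) b : GRing.lreg x ->
  (forall a, I (q ^+ k * a) -> I (q ^+ c * a)) ->
  ideal_pow I n b -> ideal_pow I n.+1 (q ^+ k * b) ->
  exists N, ideal_pow I n.+1 (f ^+ N * (q ^+ c * b)).
Proof.
move=> xreg tors /locally_principal_powdvd[l [r lr]].
move=> /locally_principal_powdvd[m [s ms]].
have [e Ie] := locally_principal_mem.
have def_r : f ^+ m * (q ^+ k * r) = f ^+ l * s * x.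
  apply: (GRing.lregX xreg : injective ( *%R (x ^+ n))).
  transitivity (f ^+ m * q ^+ k * (r * x ^+ n)); first by ring.
  rewrite -lr.
  transitivity (f ^+ l * (f ^+ m * (q ^+ k * b))); first by ring.
  by rewrite ms exprS; ring.
(* [f ^+ m] makes [q ^+ k * r] a multiple of [x], and [f ^+ e] then brings it into [I], where the
   torsion bound applies. *)
have {tors} Ir : I (q ^+ c * (f ^+ e * (f ^+ m * r))).
  apply: tors.
  rewrite (_ : _ * _ = f ^+ e * (f ^+ m * (q ^+ k * r))); last by ring.
  by rewrite def_r mulrCA; exact: idealMl.
(* [l] rewrites [b] as [r * x ^+ n], [e * n] turns [x ^+ n] into a product of [n] elements of [I],
   and [e + m] is what [Ir] consumes. *)
exists (e * n + e + m + l)%N.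
have -> : f ^+ (e * n + e + m + l) * (q ^+ c * b) =
    (f ^+ e * x) ^+ n * (q ^+ c * (f ^+ e * (f ^+ m * r))).
  rewrite !exprD -mulrA mulrCA.
  transitivity (f ^+ (e * n) * (q ^+ c * f ^+ e * f ^+ m) * (f ^+ l * b)).
    by ring.
  by rewrite lr exprMn exprM; ring.
rewrite -addn1; apply: ideal_powXM => //.
by rewrite -[_ * _]mulr1; exact: ideal_powSM.
Qed.

End LocallyPrincipal.

(** * Bounded torsion modulo powers of a Cartier divisor, and proregularity *)

Lemma quot_class_eq0 J a : is_ideal J -> quot_class J a = 0 <-> J a.
Proof.
move=> HJ; rewrite -(linear0 (@quotmod_pi R R^o J)) quotmod_piP subr0.
exact: (@submodule_gen_id R R^o).
Qed.

Lemma quot_bounded_torsionP I q :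
  is_ideal I -> bounded_torsion (quot_ideal I) q ->
  exists c, forall k a, I (q ^+ k * a) -> I (q ^+ c * a).
Proof.
move=> HI [c tors]; exists c => k a Ia.
have classZ n : q ^+ n *: quot_class I a = quot_class I (q ^+ n * a).
  by rewrite /quot_class -linearZ.
have [le_ck|/ltnW le_kc] := leqP c k; last first.
  by rewrite -(subnK le_kc) exprD -mulrA; exact: idealMl.
suff: [set u : quot_ideal I | q ^+ c *: u = 0]%classic (quot_class I a).
  by rewrite /= classZ quot_class_eq0.
by rewrite -(tors k le_ck) /= classZ quot_class_eq0.
Qed.

(** Induction on [n]: [q ^+ (c * n)] already moves [a] into [I^n], and a further factor [q ^+ c]
    moves it into [I^(n+1)] on each [D(f i)], hence globally. *)
Lemma cartier_bounded_torsion_pow I q c : effective_cartier_divisor I ->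
  (forall k a, I (q ^+ k * a) -> I (q ^+ c * a)) ->
  forall n k a, ideal_pow I n (q ^+ k * a) -> ideal_pow I n (q ^+ (c * n) * a).
Proof.
move=> [HI [r [f [x [covf fx]]]]] tors; elim=> // n IHn k a Ia.
rewrite mulnS exprD -mulrA; apply: (covering_ideal covf) => // i.
have [xreg Ix] := fx i.
apply: (locally_principal_torsion HI Ix xreg (tors k)).
  by apply: (IHn k); exact: ideal_pow_le Ia.
by rewrite mulrCA; exact: (idealMl _ (ideal_pow_is_ideal _ _)).
Qed.

Lemma cartier_bounded_torsion_proregular I q : effective_cartier_divisor I ->
  bounded_torsion (quot_ideal I) q -> proregular I q.
Proof.
move=> CI /(quot_bounded_torsionP CI.1)[c tors] n _.
(* With this [m], the exponent [m - n] is exactly the torsion bound [c * n] for [R/I^n]. *)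
exists (n + c * n)%N => [|a Ia]; first exact: leq_addr.
rewrite quot_class_eq0 // addKn.
apply: (cartier_bounded_torsion_pow CI tors).
by apply: ideal_pow_le Ia; exact: leq_addr.
Qed.

End IdealPowers.

#[local] Hint Resolve ideal_pow_is_ideal : core.

Lemma annihilator_is_ideal (R : comPzRingType) (E : lmodType R) (w : E) :
  is_ideal [set a : R | a *: w = 0]%classic.
Proof.
split=> [|c a b /= aw bw]; first exact: scale0r.
by rewrite scalerDl -scalerA aw bw scaler0 addr0.
Qed.

(** The annihilator of [u] is an ideal, so it contains the ideal generated by [J], and acting on [u]
    through a representative is well defined. *)
Lemma quot_ideal_lift (R : comPzRingType) (J : set R) (E : lmodType R) (u : E) :
  (forall a, J a -> a *: u = 0) ->
  exists g : {linear quot_ideal J -> E}, forall a, g (quot_class J a) = a *: u.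
Proof.
move=> Ju.
have genJu a : ideal_gen J a -> a *: u = 0.
  apply: (@submodule_gen_sub R R^o J [set a | a *: u = 0]%classic) => //.
  exact: annihilator_is_ideal.
pose g (x : quot_ideal J) : E := (repr x : R) *: u.
have gE a : g (quot_class J a) = a *: u.
  apply/eqP; rewrite -subr_eq0 -scalerBl; apply/eqP/genJu.
  exact/(@quotmod_piP R R^o)/reprK.
have g_lin : linear g.
  move=> a x y; rewrite -[x]reprK -[y]reprK.
  transitivity (g (quot_class J (a * repr x + repr y))).
    by rewrite /quot_class (linearP (@quotmod_pi R R^o J)).
  by rewrite !gE scalerDl scalerA.
pose gM := GRing.isLinear.Build R _ E *:%R g g_lin.
by exists (HB.pack g gM : {linear quot_ideal J -> E}).
Qed.

(** * Torsion in injective modules and divisibility *)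

Section TorsionFunctor.
Variables (R : comPzRingType) (I : set R) (q : R).
Hypothesis HI : is_ideal I.
Local Notation J := (ideal_add I (ideal_gen [set q]%classic)).

Lemma ideal_addl_sub : (I `<=` J)%classic.
Proof.
move=> a Ia; exists a => //; exists 0; last exact: addr0.
exact: ideal0 (ideal_gen_is_ideal _).
Qed.

Lemma ideal_addr_gen : J q.
Proof.
exists 0; first exact: ideal0 HI.
by exists q; [exact: (@sub_submodule_gen R R^o)|exact: add0r].
Qed.

(** Induction on [k + l]: for a factor [y + r * q] of [J], multiplying [w] by [y] lowers [l] and
    multiplying by [q] lowers [k]. If either is 0, then [w = 0]. *)
Lemma ideal_add_pow_kill (E : lmodType R) (w : E) k l :
  q ^+ k *: w = 0 -> (forall a, ideal_pow I l a -> a *: w = 0) ->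
  forall a, ideal_pow J (k + l) a -> a *: w = 0.
Proof.
have [N] := ubnP (k + l)%N; elim: N => // N IHN in k l w *.
case: k => [|k] le_klN; first by rewrite scale1r => -> _ a _; rewrite scaler0.
case: l => [|l] in le_klN *.
  by move=> _ /(_ 1 Logic.I); rewrite scale1r => -> a _; rewrite scaler0.
move=> qw Iw; rewrite addSn.
apply: (ideal_powS_ind (annihilator_is_ideal w)) => a b [y Iy [z Jz <-]] Jb.
have [r {z Jz}->] := (ideal_gen1P _ _).1 Jz; rewrite /=.
have -> : ((y + r * q) * b) *: w = b *: (y *: w) + r *: (b *: (q *: w)).
  by rewrite !scalerA -scalerDl; congr (_ *: _); ring.
rewrite (IHN k.+1 l (y *: w)); first 1 last.
- lia.
- by rewrite scalerA mulrC -scalerA qw scaler0.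
- by move=> c Ic; rewrite scalerA mulrC; apply: Iw; exact: ideal_powSM.
- by rewrite addSn -addnS.
rewrite (IHN k l.+1 (q *: w)) ?scaler0 ?addr0 //.
- by rewrite scalerA -exprSr.
- by move=> c Ic; rewrite scalerA mulrC -scalerA Iw ?scaler0.
Qed.

Lemma Gamma_sub (I' : set R) (E : lmodType R) :
  (I `<=` I')%classic -> (Gamma I' E `<=` Gamma I E)%classic.
Proof.
move=> II' u [n n_gt0 Iu]; exists n => // a Ia; apply: Iu.
exact: ideal_pow_sub Ia.
Qed.

Lemma GammaZD (E : lmodType R) a (u v : E) :
  Gamma I E u -> Gamma I E v -> Gamma I E (a *: u + v).
Proof.
move=> [n n_gt0 Iu] [m m_gt0 Iv]; exists (n + m)%N.
  by rewrite addn_gt0 n_gt0.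
move=> b Ib; rewrite scalerDr scalerA mulrC -scalerA Iu ?scaler0 ?Iv ?addr0 //.
  by apply: ideal_pow_le Ib; exact: leq_addl.
by apply: ideal_pow_le Ib; exact: leq_addr.
Qed.

Lemma injective_module_divide (E : lmodType R) (u : E) n m :
  injective_module E -> (n <= m)%N ->
  (forall a, ideal_pow I m (q ^+ m * a) -> ideal_pow I n (q ^+ (m - n) * a)) ->
  (forall a, ideal_pow I n a -> a *: u = 0) ->
  exists2 v, q ^+ (m - n) *: u = q ^+ m *: v &
    forall a, ideal_pow I m a -> a *: v = 0.
Proof.
move=> injE le_nm pro Iu.
pose N := quot_ideal (ideal_pow I m); pose cl : R -> N := quot_class _.
have clZ a b : a *: cl b = cl (a * b) by rewrite /cl /quot_class -linearZ.
have cl0 a : cl a = 0 <-> ideal_pow I m a by exact: quot_class_eq0.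
(* [R/C] models the submodule [q^m (R/I^m)]: [i] is multiplication by [q ^+ m], injective by the
   choice of [C]. The map [g] to be extended sends 1 to [q ^+ (m - n) *: u], and [v] is the image of
   1 under the extension. *)
pose C := colon (ideal_pow I m) (q ^+ m).
have [i iE] : exists i : {linear quot_ideal C -> N},
    forall a, i (quot_class C a) = a *: cl (q ^+ m).
  by apply: quot_ideal_lift => a Ca; rewrite clZ cl0 mulrC.
have [g gE] : exists g : {linear quot_ideal C -> E},
    forall a, g (quot_class C a) = a *: (q ^+ (m - n) *: u).
  by apply: quot_ideal_lift => a Ca; rewrite scalerA mulrC Iu //; exact: pro.
have i_inj : injective i.
  apply: raddf_inj => x; rewrite -[x]reprK => ix0.
  apply/quot_class_eq0; last first.
    rewrite /C /colon /= mulrC -cl0 -clZ -iE.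
    exact: ix0.
  have HIm := ideal_pow_is_ideal I m.
  split=> [|a b c]; rewrite /C /colon /= ?mulr0; first exact: ideal0 HIm.
  move=> Cb Cc; rewrite mulrDr; apply: idealD => //.
  by rewrite /GRing.scale /= mulrCA; exact: (idealMl _ HIm).
have [h hE] := injE _ _ i g i_inj.
exists (h (cl 1)) => [|a Ia]; last first.
  by rewrite -linearZ clZ mulr1 (cl0 a).2 ?linear0.
by rewrite -[LHS]scale1r -gE -hE iE scale1r -linearZ clZ mulr1.
Qed.

Lemma proregular_Gamma_divisible : proregular I q -> Gamma_quot_divisible I q.
Proof.
move=> pro E injE; apply/seteqP; split=> [u|]; last first.
  move=> _ [v Iv [w Jw <-]].
  by apply: GammaZD => //; apply: Gamma_sub Jw; exact: ideal_addl_sub.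
move=> [n n_gt0 Iu]; have [m le_nm pro_m] := pro n n_gt0.
have [a|v def_v Iv] := @injective_module_divide E u n m injE le_nm _ Iu.
  by move=> Ia; apply/quot_class_eq0 => //; exact: pro_m.
(* Since [n] is positive, [q] times this element is [q ^+ n *: v]. *)
exists (q ^+ n.-1 *: v).
  exists m => [|a Ia]; first exact: leq_trans le_nm.
  by rewrite scalerA mulrC -scalerA Iv ?scaler0.
exists (u - q ^+ n *: v); last first.
  by rewrite scalerA -exprS prednK // addrC subrK.
(* The difference [u - q ^+ n *: v] is killed by [q ^+ (m - n)] and by [I^m]. *)
exists ((m - n) + m)%N; first lia.
apply: ideal_add_pow_kill => [|a Ia].
  by rewrite scalerBr def_v scalerA -exprD subnK // subrr.
rewrite scalerBr Iu; last exact: ideal_pow_le Ia.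
by rewrite scalerA mulrC -scalerA Iv // scaler0 subrr.
Qed.

(** Writing [v = q *: w + y] gains one factor [q]; the error [y] is killed by some [q ^+ l], so each
    round raises [k] by [l]. *)
Lemma Gamma_divisible_iter (E : lmodType R) (u : E) :
  Gamma I E = [set q *: x + y | x in Gamma I E & y in Gamma J E]%classic ->
  Gamma I E u -> forall n, exists2 v, Gamma I E v &
    exists k, q ^+ k *: u = q ^+ (k + n) *: v.
Proof.
move=> divE Iu; elim=> [|n [v Iv [k def_v]]].
  by exists u => //; exists 0%N.
have [w Iw [y [l _ Jy] def_y]] :
  [set q *: x + y | x in Gamma I E & y in Gamma J E]%classic v.
  by rewrite -divE.
exists w => //; exists (l + k)%N.
rewrite exprD -scalerA def_v -def_y !scalerDr !scalerA.
rewrite [X in _ + X](_ : _ = 0) ?addr0; last first.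
  rewrite mulrC -scalerA Jy ?scaler0 //.
  by apply: ideal_powX; exact: ideal_addr_gen.
by congr (_ *: _); rewrite -!exprD -exprSr; congr (_ ^+ _); lia.
Qed.

End TorsionFunctor.

(** * Embedding an abelian group in a divisible one *)

Definition divisible (D : zmodType) : Prop :=
  forall (n : nat) (d : D), (0 < n)%N -> exists e, e *+ n = d.

Section FormalSums.
Variable A : zmodType.
Implicit Types (a b : A) (s : seq A) (c : A -> int) (f : A -> rat).

Definition delta_fun a : A -> int := fun b => (b == a)%:R.

(** Evaluation in [A] of an element [c] of the free abelian group on the set [A], with [s] meant to
    contain the support. *)
Definition formal_sum s c : A := \sum_(b <- s) b *~ c b.

Lemma formal_sum_widen s s' c : uniq s -> uniq s' -> {subset s <= s'} ->
  (forall b, b \notin s -> c b = 0) -> formal_sum s' c = formal_sum s c.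
Proof.
move=> us us' ss' c0; rewrite /formal_sum (bigID (mem s)) /= [X in _ + X]big1.
  rewrite addr0 -big_filter; apply: perm_big; apply: uniq_perm => //.
    exact: filter_uniq.
  by move=> b; rewrite mem_filter andb_idr //; exact: ss'.
by move=> b /c0 ->; rewrite mulr0z.
Qed.

Lemma formal_sum_delta s a :
  uniq s -> a \in s -> formal_sum s (delta_fun a) = a.
Proof.
move=> us sa; rewrite /formal_sum (bigD1_seq a) //= /delta_fun eqxx.
rewrite big1 ?addr0 //.
by move=> b /negPf ->.
Qed.

(* The finitely supported integral functions whose formal sum vanishes: the
   quotient of all functions A -> rat by these is divisible, and contains A
   through the classes of the delta functions. *)
Definition trivial_sum : set (zmodule (A -> rat)) := [set f |
  exists s c, [/\ uniq s, forall b, f b = (c b)%:~R,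
    forall b, b \notin s -> c b = 0 & formal_sum s c = 0]]%classic.

Lemma mulrzfctE (z : int) f : f *~ z = fun b => f b *~ z.
Proof.
by case: z => n; rewrite -?pmulrn ?NegzE ?mulrNz -?pmulrn ?natmulfctE ?opprfctE.
Qed.

Lemma trivial_sum_is_submodule : is_submodule trivial_sum.
Proof.
split=> [|z u v [s [c [us uc c0 sum0]]] [t [d [ut vd d0 sum0']]]].
  by exists [::], (fun=> 0); split; rewrite // /formal_sum big_nil.
exists (undup (s ++ t)), (fun b => c b * z + d b); split.
- exact: undup_uniq.
- move=> b; rewrite rmorphD rmorphM /= -uc -vd scalezrE addrfctE mulrzfctE.
  by rewrite mulrzr.
- move=> b; rewrite mem_undup mem_cat negb_or => /andP[/c0 -> /d0 ->].
  by rewrite mul0r addr0.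
rewrite /formal_sum; under eq_bigr do rewrite mulrzDr mulrzA.
rewrite big_split /= -mulrz_suml.
have Esum r e : uniq r -> {subset r <= s ++ t} ->
    (forall b, b \notin r -> e b = 0) ->
    formal_sum (undup (s ++ t)) e = formal_sum r e.
  move=> ur rst e0; apply: formal_sum_widen => //; first exact: undup_uniq.
  by move=> b /rst; rewrite mem_undup.
rewrite -![\sum_(b <- _) _]/(formal_sum _ _) (Esum s) ?(Esum t) ?sum0 ?sum0' //.
- by rewrite mul0rz addr0.
- by move=> b tb; rewrite mem_cat tb orbT.
- by move=> b sb; rewrite mem_cat sb.
Qed.

Definition divisible_hull : zmodType := quotmod trivial_sum.

Definition hull_inj a : divisible_hull :=
  quotmod_pi trivial_sum (fun b => (delta_fun a b)%:~R : rat).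

Lemma hull_inj_is_additive : zmod_morphism hull_inj.
Proof.
move=> a b; rewrite /hull_inj -(linearB (quotmod_pi trivial_sum)).
apply/quotmod_piP/submodule_gen_id; first exact: trivial_sum_is_submodule.
pose s := undup [:: a - b; a; b].
have sP x : x \in [:: a - b; a; b] -> formal_sum s (delta_fun x) = x.
  by move=> sx; rewrite formal_sum_delta ?undup_uniq ?mem_undup.
exists s, (fun x => delta_fun (a - b) x - (delta_fun a x - delta_fun b x)).
split=> [|x|x|].
- exact: undup_uniq.
- by rewrite !rmorphB.
- rewrite mem_undup !inE !negb_or /delta_fun.
  by move=> /and3P[/negPf-> /negPf-> /negPf->]; rewrite !subr0.
rewrite /formal_sum; under eq_bigr do rewrite !mulrzBr.
rewrite !sumrB -![\sum_(x <- _) _]/(formal_sum _ _) !sP ?subrr //.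
all: by rewrite !inE eqxx ?orbT.
Qed.

HB.instance Definition _ :=
  GRing.isZmodMorphism.Build A divisible_hull hull_inj hull_inj_is_additive.

(** Integers embed in [rat], so a relation witnessing that the class of [a] vanishes must be
    [delta_fun a], whose formal sum is [a]. *)
Lemma hull_inj_inj : injective hull_inj.
Proof.
apply: raddf_inj => a; rewrite -(linear0 (quotmod_pi trivial_sum)).
move=> /quotmod_piP/submodule_gen_id; rewrite subr0.
move=> /(_ trivial_sum_is_submodule)[s [c [us ac c0 sum0]]].
have {}ac : c = delta_fun a.
  by apply/funext => b; apply: (@intr_inj rat); rewrite -ac.
have [sa|/c0] := boolP (a \in s); last by rewrite ac /delta_fun eqxx.
by rewrite -(formal_sum_delta us sa) -ac.
Qed.

Lemma divisible_hull_divisible : divisible divisible_hull.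
Proof.
move=> n d n_gt0; rewrite -[d]reprK; move: (repr d) => f.
exists (quotmod_pi trivial_sum (fun b => f b / n%:R : rat)).
rewrite -(raddfMn (quotmod_pi trivial_sum)); congr quotmod_pi.
rewrite natmulfctE; apply/funext => b.
by rewrite -[LHS]mulr_natr divfK // pnatr_eq0 -lt0n.
Qed.

End FormalSums.

Lemma pair_mulrz (U V : zmodType) (x : U) (y : V) z :
  (x, y) *~ z = (x *~ z, y *~ z).
Proof.
by rewrite [LHS]surjective_pairing (raddfMz fst) (raddfMz snd).
Qed.

(** * Extension of additive maps into a divisible group *)

Section DivisibleInjective.
Variables (D M N : zmodType) (i : {additive M -> N}) (g : {additive M -> D}).
Hypotheses (divD : divisible D) (i_inj : injective i).

(* G is the graph of an additive map on a subgroup of N extending g along i. *)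
Definition partial_hom (G : set (N * D)) : Prop :=
  [/\ forall m, G (i m, g m), forall x y, G x -> G y -> G (x - y) &
      forall d, G (0, d) -> d = 0].

Lemma partial_homMz G x z : partial_hom G -> G x -> G (x *~ z).
Proof.
move=> [iG subG _] Gx; have G0 : G 0 by rewrite -(subrr x); exact: subG.
have GN y : G y -> G (- y) by move=> Gy; rewrite -sub0r; exact: subG.
have Gn n : G (x *+ n).
  elim: n => // n IHn; rewrite mulrSr -[X in _ + X]opprK; exact/subG/GN.
by case: z => n; rewrite ?NegzE ?mulrNz -pmulrn //; exact: GN.
Qed.

(** Baer's one-step extension: adjoin the multiples of [(b, e)] for a value [e] compatible with [G]
    on the multiples of [b] in its domain. *)
Lemma partial_hom_extend G b : partial_hom G ->
  exists2 H, partial_hom H & (G `<=` H)%classic /\ exists e, H (b, e).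
Proof.
move=> HG; have [iG subG funG] := HG.
have G0 : G 0 by rewrite -(subrr (i 0, g 0)); exact: subG.
(* If no positive multiple of [b] is in the domain, [e = 0] works. Otherwise take the least such
   multiple [b *+ n] and divide its value by [n]. *)
have [e eP] : exists e, forall (z : int) d, G (b *~ z, d) -> d = e *~ z.
  have [exG|noG] :=
    pselect (exists n, (0 < n)%N && `[< exists d, G (b *+ n, d) >]); last first.
    have noGz z d : G (b *~ z, d) -> z = 0.
      move=> Gd; apply/eqP/negPn/negP => z_neq0; case: noG; exists `|z|%N.
      rewrite absz_gt0 z_neq0; apply/asboolP; exists (d *~ sgz z).
      by rewrite pmulrn abszEsg mulrC mulrzA -pair_mulrz; exact: partial_homMz.
    exists 0 => z d Gd; rewrite mul0rz; apply: funG.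
    by rewrite -(mulr0z b) -(noGz _ _ Gd).
  have [n /andP[n_gt0 /asboolP[d0 Gd0]] n_min] := ex_minnP exG.
  have [e def_d0] := divD d0 n_gt0; exists e => z d Gd.
  have Gr : G (b *~ (z %% n)%Z, d - d0 *~ (z %/ n)%Z).
    have -> : (b *~ (z %% n)%Z, d - d0 *~ (z %/ n)%Z) =
        (b *~ z, d) - (b *+ n, d0) *~ (z %/ n)%Z.
      rewrite pair_mulrz /modz mulrzBr; congr pair.
      by rewrite mulrC mulrzA.
    by apply: subG => //; exact: partial_homMz.
  (* A nonzero remainder would be a smaller positive multiplier, against the minimality of [n]. *)
  have r0 : (z %% n)%Z = 0.
    apply/eqP/negPn/negP => r_neq0; have n_neq0 : n%:Z != 0 by rewrite -lt0n.
    have lt_n : (z %% n)%Z < n by apply: ltz_pmod; rewrite ltz_nat.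
    have := modz_ge0 z n_neq0.
    case: (z %% n)%Z Gr r_neq0 lt_n => // r Gr r_neq0.
    rewrite ltz_nat ltnNge => /negP[]; apply: n_min; rewrite lt0n r_neq0.
    by apply/asboolP; exists (d - d0 *~ (z %/ n)%Z).
  move: Gr; rewrite r0 mulr0z => /funG/eqP; rewrite subr_eq0 => /eqP->.
  by rewrite [in RHS](divz_eq z n) r0 addr0 mulrC mulrzA -pmulrn def_d0.
pose H := [set x | exists y z, G y /\ x = y + (b, e) *~ z]%classic.
exists H; last first.
  split=> [x Gx|]; first by exists x, 0; rewrite mulr0z addr0.
  by exists e, 0, 1; rewrite mulr1z add0r.
split=> [m|_ _ [x [z [Gx ->]]] [y [t [Gy ->]]]|d [[x c] [z [Gx]]]].
- by exists (i m, g m), 0; rewrite mulr0z addr0.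
- exists (x - y), (z - t); split; first exact: subG.
  by rewrite mulrzBr opprD addrACA.
rewrite pair_mulrz => -[] /esym/eqP; rewrite addr_eq0 => /eqP def_x ->.
by have := eP (- z) c; rewrite !mulrNz -def_x => /(_ Gx) ->; rewrite addNr.
Qed.

(** Zorn's lemma gives a maximal graph; by the one-step extension its domain is all of [N], so it is
    the graph of [h]. *)
Lemma divisible_extend : exists h : {additive N -> D}, forall m, h (i m) = g m.
Proof.
have PH0 : partial_hom [set (i m, g m) | m in setT]%classic.
  split=> [m|_ _ [m _ <-] [n _ <-]|d [m _ []]]; first by exists m.
    by exists (m - n) => //; rewrite !raddfB.
  by rewrite -(raddf0 i) => /i_inj -> <-; exact: raddf0.
(* set0 is allowed because Zorn_bigcup also requires the empty chain. *)
have [F FP Ftot|G [[G0|HG] maxG]] := @Zorn_bigcup (N * D)%type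
  [set G | G = set0 \/ partial_hom G]%classic; last first.
- have dom x : exists d, G (x, d).
    have [H HH [GH [e He]]] := partial_hom_extend x HG.
    exists e; apply: contrapT => Ge; apply: (maxG H); last by right.
    by split=> // HG'; exact/Ge/HG'.
  have [iG subG funG] := HG.
  have [h hP] := choice dom.
  have hE x d : G (x, d) -> h x = d.
    move=> Gd; apply/eqP; rewrite -subr_eq0; apply/eqP/funG.
    by rewrite -(subrr x); exact: (subG _ _ (hP x) Gd).
  have h_add : zmod_morphism h.
    by move=> x y; apply: hE; exact: (subG _ _ (hP x) (hP y)).
  pose hM := GRing.isZmodMorphism.Build N D h h_add.
  exists (HB.pack h hM : {additive N -> D}) => m; exact: hE.
(* A maximal element is not empty, since the graph of [g] along [i] is strictly larger. *)
- case: (maxG _ _ (or_intror PH0)); rewrite G0; split=> [|/(_ (i 0, g 0))] //.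
  by apply; exists 0.
(* A chain without a genuine graph has empty union; otherwise one member supplies the values along
   [i]. *)
have [[G [FG HG]]|noG] := pselect (exists G, F G /\ partial_hom G); last first.
  left; rewrite -subset0 => x [G FG Gx].
  have [G0|HG] := FP G FG; first by rewrite G0 in Gx.
  by case: noG; exists G.
right; split=> [m|x y [H FH Hx] [K FK Ky]|d [H FH Hd]].
- by exists G => //; case: HG.
- have [L FL [Lx Ly]] : exists2 L, F L & L x /\ L y.
    by have [HK|KH] := Ftot H K FH FK; [exists K|exists H] => //; split=> //;
      [exact: HK|exact: KH].
  exists L => //; have [L0|[_ subL _]] := FP L FL; last exact: subL.
  by rewrite L0 in Lx.
have [H0|[_ _ funH]] := FP H FH; last exact: funH.
by rewrite H0 in Hd.
Qed.

End DivisibleInjective.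

(** * Coinduced modules *)

Section CoinducedModule.
Variables (R : comPzRingType) (D : zmodType).

Definition additive_fun : pred (R -> D) := fun f => `[< zmod_morphism f >].

Lemma additive_fun_zmod_closed : zmod_closed additive_fun.
Proof.
split=> [|f g /asboolP fD /asboolP gD]; apply/asboolP => a b /=.
  by rewrite subr0.
by rewrite !fctE fD gD !opprD !opprK addrACA.
Qed.

HB.instance Definition _ :=
  GRing.isZmodClosed.Build (R -> D) additive_fun additive_fun_zmod_closed.

(* Hom_Z(R, D), with R acting through the argument: maps of R-modules to it are
   additive maps to D, so it is injective when D is divisible. *)
Record coind := Coind {
  coind_val :> R -> D;
  coindP : coind_val \in additive_fun }.

HB.instance Definition _ := [isSub for coind_val].
HB.instance Definition _ := [Choice of coind by <:].
HB.instance Definition _ := [SubChoice_isSubZmodule of coind by <:].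

Lemma coindB (f : coind) : zmod_morphism f.
Proof. exact/asboolP/coindP. Qed.

HB.instance Definition _ (f : coind) :=
  GRing.isZmodMorphism.Build R D (coind_val f) (coindB f).

Lemma coind_scale_subproof (a : R) (f : coind) :
  (fun r => f (r * a)) \in additive_fun.
Proof. by apply/asboolP => r s; rewrite mulrBl coindB. Qed.

Definition coind_scale a f := Coind (coind_scale_subproof a f).

Lemma coind_scaleA a b f :
  coind_scale a (coind_scale b f) = coind_scale (a * b) f.
Proof. by apply/val_inj/funext => r /=; rewrite mulrA. Qed.

Lemma coind_scale1 : left_id 1 coind_scale.
Proof. by move=> f; apply/val_inj/funext => r /=; rewrite mulr1. Qed.

Lemma coind_scaleDr : right_distributive coind_scale +%R.
Proof. by move=> a f g; apply/val_inj/funext => r. Qed.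

Lemma coind_scaleDl f : {morph coind_scale^~ f : a b / a + b}.
Proof.
by move=> a b; apply/val_inj/funext => r; rewrite /= mulrDr raddfD.
Qed.

HB.instance Definition _ := GRing.Zmodule_isLmodule.Build R coind
  coind_scaleA coind_scale1 coind_scaleDr coind_scaleDl.

(** Adjunction with restriction of scalars; evaluating at [r = 1] recovers [h]. *)
Lemma coind_lift (M : lmodType R) (h : {additive M -> D}) :
  exists H : {linear M -> coind}, forall u r, H u r = h (r *: u).
Proof.
have HP u : (fun r => h (r *: u)) \in additive_fun.
  by apply/asboolP => r s; rewrite scalerBl raddfB.
pose H u := Coind (HP u).
have H_lin : linear H.
  move=> a u v; apply/val_inj/funext => r.
  by rewrite /= scalerDr scalerA raddfD.
pose HM := GRing.isLinear.Build R M coind *:%R H H_lin.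
by exists (HB.pack H HM : {linear M -> coind}).
Qed.

(** Evaluate [g] at 1, extend the additive map so obtained to [N], and transpose back. *)
Lemma coind_injective : divisible D -> injective_module coind.
Proof.
move=> divD M N i g i_inj.
have g1B : zmod_morphism (fun u => g u 1) by move=> u v; rewrite linearB.
pose g1M := GRing.isZmodMorphism.Build M D _ g1B.
pose g1 : {additive M -> D} := HB.pack (fun u => g u 1) g1M.
have [h hE] := divisible_extend g1 divD i_inj.
have [H HE] := coind_lift h.
exists H => u; apply/val_inj/funext => r.
by rewrite /= HE -linearZ hE /= linearZ /= mul1r.
Qed.

End CoinducedModule.

(** * Enough injectives, and proregularity from divisibility *)

Lemma enough_injectives (R : comPzRingType) (M : lmodType R) :
  exists (E : lmodType R) (i : {linear M -> E}),
    injective_module E /\ injective i.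
Proof.
have [i iE] := coind_lift (@hull_inj M).
exists (coind R (divisible_hull M)), i; split.
  exact/coind_injective/divisible_hull_divisible.
apply: raddf_inj => u iu0; apply: hull_inj_inj.
by rewrite -[u in LHS]scale1r -iE iu0 raddf0.
Qed.

Lemma Gamma_divisible_proregular (R : comPzRingType) (I : set R) (q : R) :
  is_ideal I -> Gamma_quot_divisible I q -> proregular I q.
Proof.
move=> HI div n n_gt0.
have [E [i [injE i_inj]]] := enough_injectives (quot_ideal (ideal_pow I n)).
pose u := i (quot_class _ 1).
(* The annihilator of [u] is exactly [I^n], so vanishing in [R/I^n] can be tested on [u]. *)
have uE a : a *: u = 0 <-> quot_class (ideal_pow I n) a = 0.
  have -> : a *: u = i (quot_class (ideal_pow I n) a).
    by rewrite /u -linearZ /quot_class -linearZ /= [_ *: _]mulr1.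
  by split=> [|->]; [rewrite -(linear0 i); exact: i_inj|exact: linear0].
have Iu : Gamma I E u.
  by exists n => // a Ia; apply/uE/quot_class_eq0.
have [v [l _ Iv] [k def_v]] := Gamma_divisible_iter HI (div E injE) Iu n.
(* Here [m - n = l + k]: the factor [q ^+ k] trades [u] for [q ^+ (k + n) *: v], and [q ^+ l]
   completes the power to [q ^+ m]. Then [q ^+ m * a] lies in [I^m], hence in [I^l], which kills
   [v]. *)
exists (k + n + l)%N => [|a Ia]; first lia.
apply/uE.
have -> : (k + n + l - n = l + k)%N by lia.
have -> : (q ^+ (l + k) * a) *: u = (q ^+ l * a) *: (q ^+ k *: u).
  by rewrite scalerA exprD; congr (_ *: _); ring.
rewrite def_v scalerA; apply: Iv.
have -> : q ^+ l * a * q ^+ (k + n) = q ^+ (k + n + l) * a.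
  by rewrite !exprD; ring.
by apply: ideal_pow_le Ia; lia.
Qed.

Unset Implicit Arguments.

Theorem corollary0p3 (p : nat) (p_prime : prime p) (R : comPzRingType)
    (algR : {rmorphism Zlocal p -> R}) (delta : R -> R) (I : set R) (prismRI : is_prism p delta I) :
  (bounded_torsion (quot_ideal I) p%:R ->
     proregular I p%:R /\ Gamma_quot_divisible I p%:R) /\
  (proregular I p%:R <-> Gamma_quot_divisible I p%:R).
Proof.
have CI := prism_cartier prismRI; have HI := CI.1.
split=> [tors|]; last first.
  split; first exact: proregular_Gamma_divisible.
  exact: Gamma_divisible_proregular.
have pro := cartier_bounded_torsion_proregular CI tors.
by split=> //; exact: proregular_Gamma_divisible.
Qed.
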